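(* Let $q$ be a prime power, let $n$ be a positive integer, and let $f\in \mathbb{F}_q[x]$ be a divisor of $x^n-1$ of degree $k$. Let $n_f$ be the number of normal elements $\alpha\in \mathbb{F}_{q^n}$ (over $\mathbb{F}_q$) such that $L_f(\alpha)$ is primitive. Then $$\frac{n_f}{\theta(q^n-1)\,\Theta(x^n-1)}>q^n-q^{n/2+k}\,W(q^n-1)\,W(x^n-1).$$ In particular, if $q^{n/2-k}\ge W(q^n-1)W(x^n-1)$, then there exist primitive $k$-normal elements in $\mathbb{F}_{q^n}$.
   Context: For $f(x)=\sum_{i=0}^r a_ix^i\in\mathbb{F}_q[x]$, its $q$-associate is $L_f(x)=\sum_{i=0}^r a_ix^{q^i}$. An element $\alpha\in\mathbb{F}_{q^n}$ is normal over $\mathbb{F}_q$ if $\alpha,\alpha^q,\dots,\alpha^{q^{n-1}}$ form a basis of $\mathbb{F}_{q^n}$ over $\mathbb{F}_q$; it is $k$-normal over $\mathbb{F}_q$ if the $\mathbb{F}_q$-span of $\alpha,\alpha^q,\dots,\alpha^{q^{n-1}}$ has dimension $n-k$. An element is primitive if it generates the cyclic group $\mathbb{F}_{q^n}^*$. For a positive integer $t$, $\theta(t)=\varphi(t)/t$ with $\varphi$ Euler's function, and $W(t)$ is the number of squarefree positive divisors of $t$. For a monic $T\in\mathbb{F}_q[x]$, $\Phi_q(T)=|(\mathbb{F}_q[x]/\langle T\rangle)^*|$, $\Theta(T)=\Phi_q(T)/q^{\deg T}$, and $W(T)$ is the number of squarefree monic divisors of $T$ in $\mathbb{F}_q[x]$.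 *)

(* Defs.v *)
From HB Require Import structures.
From mathcomp Require Import all_boot all_order all_algebra all_field.
Set Implicit Arguments. Unset Strict Implicit. Unset Printing Implicit Defensive.
Import GRing.Theory Num.Theory.
Local Open Scope ring_scope.

Definition sqfree_nat (m : nat) : bool :=
  (0 < m)%N && [forall d : 'I_m.+1, (1 < d)%N ==> ~~ (d * d %| m)%N].

Definition Wnat (t : nat) : nat := count sqfree_nat (divisors t).

Definition theta (t : nat) : rat := (totient t)%:R / t%:R.

(* squarefree polynomial: nonzero, and no square of a nonconstant polynomial
   divides it.  Any g with g*g %| p (p <> 0) has size g <= size p, so quantifying
   over {poly_(size p) F} covers all candidate g. *)
Definition sqfree_poly (F : finFieldType) (p : {poly F}) : bool :=
  (p != 0) && [forall g : {poly_(size p) F}, (polyn g * polyn g %| p) ==> (size (polyn g) <= 1)%N].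

(* W(T) : number of squarefree monic divisors of T in F[x] (all have size <= size T) *)
Definition Wpoly (F : finFieldType) (T : {poly F}) : nat :=
  #|[pred g : {poly_(size T) F} |
      [&& polyn g \is monic, polyn g %| T & sqfree_poly (polyn g)]]|.

(* Phi_q(T) = |(F[x]/<T>)^*|, for monic T of degree >= 1 *)
Definition Phi_poly (F : finFieldType) (T : {poly F}) : nat :=
  #|[pred u : {poly %/ T} | u \is a GRing.unit]|.

Definition Theta_poly (F : finFieldType) (T : {poly F}) : rat :=
  (Phi_poly T)%:R / (#|F| ^ (size T).-1)%:R.

Section Ext.
Variables (F : finFieldType) (L : fieldExtType F).

Definition conjs (a : L) : seq L := [seq a ^+ (#|F| ^ i) | i <- iota 0 (\dim {:L})].

Definition k_normal (k : nat) (a : L) : bool :=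
  \dim <<conjs a>>%VS == (\dim {:L} - k)%N.

Definition normal_elt (a : L) : bool := basis_of fullv (conjs a).

Definition primitive_elt (a : L) : bool := (#|F| ^ \dim {:L} - 1).-primitive_root a.

Definition q_assoc (f : {poly F}) (a : L) : L :=
  \sum_(i < size f) f`_i *: a ^+ (#|F| ^ i).

Definition n_f (f : {poly F}) : nat :=
  #|[pred a : finvect_type L | normal_elt a && primitive_elt (q_assoc f a)]|.
End Ext.

(* Main.v *)
Require Import Defs.
From HB Require Import structures.
From mathcomp Require Import all_boot all_order all_algebra all_fingroup all_field.
From mathcomp Require Import all_character ring.
Set Implicit Arguments.
Unset Strict Implicit.
Unset Printing Implicit Defensive.
Import Order.TTheory GRing.Theory Num.Theory.
Local Open Scope ring_scope.

(** Write [K] for the field of order [Q = q^n] and [N = Q - 1].  With a generator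
    [g] of [K^*], the power [g^i] is primitive iff no prime [l] of [N] divides [i],
    so the indicator of primitivity is the product of the [1 - 1_(l %| i)]; each
    factor is a combination of multiplicative characters with coefficients of
    total absolute value [2 (1 - 1/l)], whence a total of at most
    [2^omega(N) theta(N)], and the trivial character gets [theta(N)].  Likewise [a]
    is normal iff it avoids the kernels of [L_(T/P)] for [P] a monic irreducible
    factor of [T = x^n - 1]; such a kernel has index [q^deg P], which gives an
    expansion in additive characters of total mass at most [2^omega(T) Theta(T)].
    For a nontrivial [eta], detecting [b = L_f(a)] additively bounds
    [sum_a psi(c a) eta(L_f a)] by [q^k] Gauss sums of modulus at most [sqrt Q].
    When [k < n] a normal [a] has [L_f(a) <> 0], so the trivial [eta] contributes
    exactly [theta Theta Q]; when [k = n] the claimed lower bound is negative.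
    Only [2^omega <= W] is needed for both factors.  Finally [L_f] maps the span of
    the conjugates of a normal element onto its image, of dimension [n - k]. *)

(** * Characters and absolutely bounded Fourier expansions *)

(** Translation by some [w] in [V] with [chi w != 1] permutes [V] and multiplies the sum by [chi w],
    so the sum vanishes. *)
Lemma sum_character (X : finZmodType) (V : {set X}) (chi : X -> algC) :
    {in V &, forall x y, x + y \in V} -> {in V, forall x, - x \in V} ->
    {morph chi : x y / x + y >-> x * y} ->
  \sum_(v in V) chi v = if [forall v in V, chi v == 1] then #|V|%:R else 0.
Proof.
move=> VD VN chiD; case: ifPn => [/forall_inP chi1 | /forall_inPn[w Vw chiw]].
  by rewrite (eq_bigr (fun=> 1)) => [|v /chi1/eqP//]; rewrite sumr_const.
have: chi w * \sum_(v in V) chi v = \sum_(v in V) chi v.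
  rewrite [RHS](reindex_inj (addrI w)) mulr_sumr /=.
  apply: eq_big => [v|v _]; last by rewrite chiD.
  apply/idP/idP => [Vv|Vwv]; first exact: VD.
  by rewrite -(addKr w v); apply: VD => //; apply: VN.
move=> e; apply/eqP; move/eqP: e.
by rewrite -subr_eq0 -[X in _ - X]mul1r -mulrBl mulf_eq0 subr_eq0 (negPf chiw).
Qed.

Lemma sum_characterT (X : finZmodType) (chi : X -> algC) :
    {morph chi : x y / x + y >-> x * y} ->
  \sum_x chi x = if [forall x, chi x == 1] then #|X|%:R else 0.
Proof.
move=> chiD; rewrite -(eq_bigl _ _ (in_setT (T := X))).
rewrite (sum_character _ _ chiD) ?cardsT; do ?by move=> *; rewrite in_setT.
by congr (if _ then _ else _); apply: eq_forallb => x; rewrite in_setT.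
Qed.

Section FourierAlgebra.
Variables (J : finZmodType) (X : Type) (chi : J -> X -> algC).
Hypothesis chi0 : forall x, chi 0 x = 1.
Hypothesis chiD : forall i j x, chi (i + j) x = chi i x * chi j x.

(** The Wiener algebra norm: [r] bounds the l1 norm of some family of coefficients for [u]. A
    uniform bound on the sums against each [chi j] then costs only a factor [r] when [chi j] is
    replaced by [u]. *)
Definition fourier_bound (u : X -> algC) (r : algC) :=
  exists2 c : J -> algC, forall x, u x = \sum_j c j * chi j x & \sum_j `|c j| <= r.

Lemma fourier_bound1 : fourier_bound (fun=> 1) 1.
Proof.
exists (fun j => (j == 0)%:R) => [x|].
  by rewrite (bigD1 0) //= eqxx mul1r chi0 big1 ?addr0 // => j /negPf->; rewrite mul0r.
by rewrite (bigD1 0) //= eqxx normr1 big1 ?addr0 // => j /negPf->; rewrite normr0.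
Qed.

(** A product of expansions has the convolution of the coefficients, and the l1 norm is
    submultiplicative under convolution. *)
Lemma fourier_boundM u v r s :
  fourier_bound u r -> fourier_bound v s -> fourier_bound (fun x => u x * v x) (r * s).
Proof.
move=> [c uE cr] [d vE ds].
exists (fun k => \sum_i c i * d (k - i)) => [x|].
  rewrite uE vE mulr_suml; under [RHS]eq_bigr do rewrite mulr_suml.
  rewrite exchange_big /=; apply: eq_bigr => i _.
  rewrite mulr_sumr (reindex_inj (addIr (- i))) /=; apply: eq_bigr => k _.
  have ->: chi k x = chi i x * chi (k - i) x by rewrite -chiD addrC subrK.
  by rewrite mulrACA.
apply: le_trans (ler_pM _ _ cr ds); rewrite ?sumr_ge0 //.
apply: (@le_trans _ _ (\sum_k \sum_i `|c i| * `|d (k - i)|)).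
  by apply: ler_sum => k _; apply: le_trans (ler_norm_sum _ _ _) _;
     apply: ler_sum => i _; rewrite normrM.
rewrite exchange_big mulr_suml; apply: ler_sum => i _ /=.
by rewrite mulr_sumr [leRHS](reindex_inj (addIr (- i))).
Qed.

Lemma fourier_bound_prod (I : eqType) (s : seq I) (u : I -> X -> algC) (r : I -> algC) :
    {in s, forall i, fourier_bound (u i) (r i)} ->
  fourier_bound (fun x => \prod_(i <- s) u i x) (\prod_(i <- s) r i).
Proof.
elim: s => [_|i s IHs us].
  have [c cE cr] := fourier_bound1.
  by exists c => [x|]; rewrite big_nil ?cE.
have [||c cE cr] := fourier_boundM (us i _) (IHs _); rewrite ?mem_head //.
  by move=> j sj; apply: us; rewrite in_cons sj orbT.
by exists c => [x|]; rewrite big_cons ?cE.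
Qed.

(* The trivial character keeps the coefficient [1 - 1/m] and the other [m - 1]
   characters of [H] get [-1/m] each. *)
Lemma fourier_bound_complement (H : {set J}) (u : X -> algC) :
    0 \in H -> (forall x, u x = 1 - (#|H|%:R)^-1 * \sum_(j in H) chi j x) ->
  fourier_bound u (2%:R * (1 - (#|H|%:R)^-1)).
Proof.
move=> H0 uE; have Hgt0: (0 < #|H|)%N by apply/card_gt0P; exists 0.
set m := #|H| in uE Hgt0 *.
exists (fun j => (j == 0)%:R - (j \in H)%:R / m%:R) => [x|].
  rewrite uE; under [RHS]eq_bigr do rewrite mulrBl.
  rewrite sumrB; congr (_ - _).
    by rewrite (bigD1 0) //= eqxx mul1r chi0 big1 ?addr0 // => j /negPf->; rewrite mul0r.
  rewrite mulr_sumr [LHS]big_mkcond; apply: eq_bigr => j _.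
  by case: (j \in H); rewrite ?mul1r // !mul0r.
rewrite (bigD1 0) //= eqxx H0 mul1r.
have m1: m%:R^-1 <= 1 :> algC by rewrite invf_le1 ?ler1n ?ltr0n.
rewrite ger0_norm ?subr_ge0 // mulr_natl mulr2n lerD2l.
rewrite (eq_bigr (fun j : J => (j \in H)%:R / m%:R)) => [|j /negPf->]; last first.
  by rewrite sub0r normrN ger0_norm ?divr_ge0 ?ler0n.
have Hm: (\sum_(j : J | j != 0%R) (j \in H) + 1 = m)%N.
  by rewrite /m -sum1_card [RHS]big_mkcond [RHS](bigD1 0) //= H0 addnC; congr (_ + _)%N;
     apply: eq_bigr => j _; case: (j \in H).
rewrite -mulr_suml -natr_sum lerBrDr -[X in _ + X]mul1r -mulrDl natr1 -addn1 Hm.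
by rewrite mulfV // pnatr_eq0 -lt0n.
Qed.

End FourierAlgebra.

(** The additive group is abelian of order above 1, so it has more than one irreducible character
    and all are linear; the one of index 1 differs from ['chi_0], the trivial one. *)
Lemma exists_additive_character (K : finFieldType) :
  exists2 psi : K -> algC, {morph psi : x y / x + y >-> x * y}
    & (forall x, `|psi x| = 1) /\ exists x, psi x != 1.
Proof.
have cG: abelian [set: K] := FinRing.zmod_abelian _.
pose G := [set: K]%G; have lin i := char_abelianP G cG i.
have Nirr_gt1: (1 < Nirr G)%N.
  rewrite NirrE (eqP _ : #|classes G| = #|G|); first by rewrite cardsT finNzRing_gt1.
  by rewrite -card_classes_abelian.
pose i : Iirr G := Ordinal Nirr_gt1.
exists 'chi_i; last split => [x|].
- by move=> x y; apply: (lin_charM (lin i)); rewrite inE.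
- by apply: (normC_lin_char (lin i)); rewrite inE.
apply/existsP; apply: contraT; rewrite negb_exists => /forallP chi1.
have /eqP: 'chi_i = 1 by apply/cfunP => x; rewrite cfun1E inE; have:= chi1 x; rewrite negbK => /eqP.
by rewrite -(irr0) (inj_eq irr_inj).
Qed.

(** * Orthogonality and annihilators for a nontrivial additive character *)

Section AdditiveCharacter.
Variables (K : finFieldType) (psi : K -> algC).
Hypothesis psiD : {morph psi : x y / x + y >-> x * y}.
Hypothesis psi_norm : forall x, `|psi x| = 1.
Hypothesis psi_nontriv : exists x, psi x != 1.

Lemma psi0 : psi 0 = 1.
Proof.
have := psiD 0 0; rewrite addr0 => /eqP.
have nz: psi 0 != 0 by rewrite -normr_eq0 psi_norm oner_neq0.
by rewrite -[X in X == _]mulr1 (inj_eq (mulfI nz)) => /eqP.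
Qed.

Lemma psiN x : psi (- x) = (psi x)^*.
Proof.
have nz: psi x != 0 by rewrite -normr_eq0 psi_norm oner_neq0.
by apply: (mulfI nz); rewrite -psiD subrr psi0 -normCK psi_norm expr1n.
Qed.

Lemma sum_psi (c : K) : \sum_x psi (x * c) = if c == 0 then #|K|%:R else 0.
Proof.
rewrite (sum_characterT (chi := fun x => psi (x * c))); last first.
  by move=> x y; rewrite mulrDl psiD.
have [->|nzc] := eqVneq c 0.
  by case: forallP => // -[] x; rewrite mulr0 psi0.
case: forallP => // psi1; have [x /eqP[]] := psi_nontriv.
by have:= psi1 (x / c); rewrite mulfVK // => /eqP.
Qed.

(** Orthogonal of [V] for the pairing [psi (c * v)], which identifies [K] with its own group of
    additive characters. *)
Definition psi_ann (V : {set K}) : {set K} := [set c | [forall v in V, psi (c * v) == 1]].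

Lemma psi_annP (V : {set K}) c : reflect {in V, forall v, psi (c * v) = 1} (c \in psi_ann V).
Proof. by rewrite inE; apply: (iffP forall_inP) => h v /h/eqP. Qed.

Section Annihilator.
Variable V : {set K}.
Hypothesis V0 : 0 \in V.
Hypothesis VD : {in V &, forall x y, x + y \in V}.
Hypothesis VN : {in V, forall x, - x \in V}.

Lemma psi_annD : {in psi_ann V &, forall x y, x + y \in psi_ann V}.
Proof.
move=> x y /psi_annP hx /psi_annP hy; apply/psi_annP => v Vv.
by rewrite mulrDl psiD hx ?hy ?mulr1.
Qed.

Lemma psi_annN : {in psi_ann V, forall x, - x \in psi_ann V}.
Proof.
by move=> x /psi_annP hx; apply/psi_annP => v Vv; rewrite mulNr psiN hx ?conjC1.
Qed.

Lemma psi_ann0 : 0 \in psi_ann V.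
Proof. by apply/psi_annP => v _; rewrite mul0r psi0. Qed.

Lemma sum_psi_set c : \sum_(v in V) psi (c * v) = if c \in psi_ann V then #|V|%:R else 0.
Proof.
rewrite (@sum_character K V (fun v => psi (c * v))) ?inE // => x y.
by rewrite mulrDr psiD.
Qed.

(** Double counting of the sum of all [psi (c * v)]: summing over [c] first leaves [v = 0], summing
    over [v] first leaves the annihilator. *)
Lemma card_psi_ann : (#|V| * #|psi_ann V| = #|K|)%N.
Proof.
apply/eqP; rewrite -(eqr_nat algC) natrM.
have: \sum_(v in V) \sum_c psi (c * v) = #|K|%:R.
  rewrite (bigD1 0) //= sum_psi eqxx big1 ?addr0 // => v /andP[_ /negPf nzv].
  by rewrite sum_psi nzv.
move <-; rewrite exchange_big /=; under eq_bigr do rewrite sum_psi_set.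
by rewrite -big_mkcond sumr_const mulr_natr.
Qed.
End Annihilator.

(** Biduality: [V] lies in its double annihilator and has the same order, so orthogonality over
    [psi_ann V] detects [V] exactly. *)
Lemma indicator_psi_ann (V : {set K}) a :
    0 \in V -> {in V &, forall x y, x + y \in V} -> {in V, forall x, - x \in V} ->
  (a \in V)%:R = (#|psi_ann V|%:R)^-1 * \sum_(c in psi_ann V) psi (c * a).
Proof.
move=> V0 VD VN; set A := psi_ann V.
have A0: 0 \in A := psi_ann0 V.
have nzA: #|A|%:R != 0 :> algC by rewrite pnatr_eq0 -lt0n; apply/card_gt0P; exists 0.
have AA: psi_ann A = V.
  apply/esym/eqP; rewrite eqEcard; apply/andP; split.
    by apply/subsetP => v Vv; apply/psi_annP => c /psi_annP; rewrite mulrC; apply.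
  have /eqP := card_psi_ann A0 (@psi_annD V) (@psi_annN V).
  rewrite -(card_psi_ann V0 VD VN) mulnC eqn_pmul2r; first by move/eqP->.
  by apply/card_gt0P; exists 0.
under eq_bigr do rewrite mulrC.
rewrite sum_psi_set; [|exact: psi_annD|exact: psi_annN].
by rewrite AA; case: ifP; rewrite ?mulVf ?mulr0.
Qed.

(** * Gauss sums and mixed character sums *)

Section GaussSum.
Variable eta : K -> algC.
Hypothesis eta0 : eta 0 = 0.
Hypothesis etaM : {morph eta : x y / x * y}.
Hypothesis eta_norm : forall x : K, x != 0 -> `|eta x| = 1.
Hypothesis eta_nontriv : exists2 x : K, x != 0 & eta x != 1.

Let gauss (t : K) := \sum_(b : K) eta b * psi (t * b).

(** The sum at 0 vanishes and the substitution [b -> s * b] gives all others the same modulus, so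
    Parseval determines this modulus. *)
Lemma norm_gauss_le t : `|gauss t| <= sqrtC #|K|%:R.
Proof.
have g0: gauss 0 = 0.
  have [w nzw etaw] := eta_nontriv.
  have e: eta w * gauss 0 = gauss 0.
    rewrite [RHS](reindex_inj (mulfI nzw)) mulr_sumr; apply: eq_bigr => b _.
    by rewrite etaM !mul0r mulrA.
  apply/eqP; move/eqP: e.
  by rewrite -subr_eq0 -[X in _ - X]mul1r -mulrBl mulf_eq0 subr_eq0 (negPf etaw).
have gE s: s != 0 -> `|gauss s| = `|gauss 1|.
  move=> nzs; rewrite -[LHS]mul1r -(eta_norm nzs) -normrM; congr `|_|.
  rewrite [RHS](reindex_inj (mulfI nzs)) mulr_sumr; apply: eq_bigr => b _.
  by rewrite etaM mul1r mulrA.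
(* Expand the square and sum over [s] first: only the diagonal survives, and each nonzero [b]
   contributes [#|K|]. *)
have parseval: \sum_s `|gauss s| ^+ 2 = #|K|%:R * #|K|.-1%:R.
  under eq_bigr => s _.
    rewrite normCK rmorph_sum mulr_suml.
    under eq_bigr => b _.
      rewrite mulr_sumr.
      under eq_bigr => b' _ do rewrite rmorphM /= -psiN mulrACA -psiD -mulrN -mulrDr.
      over.
    over.
  rewrite exchange_big /=; under eq_bigr do rewrite exchange_big /=.
  rewrite (eq_bigr (fun b => (b != 0)%:R * #|K|%:R)) => [|b _].
    rewrite -mulr_suml -natr_sum mulrC; congr (_ * _%:R).
    rewrite -(cardC1 (0 : K)) -sum1_card [RHS]big_mkcond.
    by apply: eq_bigr => b _; rewrite inE; case: (b == 0).
  rewrite (bigD1 b) //= -mulr_sumr sum_psi subrr eqxx big1 ?addr0 => [|b' nb].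
    have [->|nzb] := eqVneq b 0; first by rewrite eta0 !mul0r.
    by rewrite -normCK eta_norm ?expr1n.
  by rewrite -mulr_sumr sum_psi subr_eq0 eq_sym (negPf nb) mulr0.
have [->|nzt] := eqVneq t 0; first by rewrite g0 normr0 sqrtC_ge0 ler0n.
rewrite gE //; have Q1: (0 < #|K|.-1)%N.
  by rewrite -ltnS prednK ?finNzRing_gt1 // ltnW ?finNzRing_gt1.
suff ->: #|K|%:R = `|gauss 1| ^+ 2 by rewrite sqrCK.
move: parseval; rewrite (bigD1 0) //= g0 normr0 expr0n add0r.
rewrite (eq_bigr (fun=> `|gauss 1| ^+ 2)) => [|s /gE->//].
rewrite sumr_const cardC1 -[LHS]mulr_natr => /mulIf->//.
by rewrite pnatr_eq0 -lt0n.
Qed.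

(* Detecting [b = l a] by additive characters [psi (t * _)] leaves the Gauss sums
   of those [t] for which [a |-> psi (c * a + t * l a)] is trivial. *)
Lemma norm_mixed_sum_le (l : K -> K) (kappa : nat) (c : K) :
    {morph l : x y / x + y} -> (#|l @: K| * kappa = #|K|)%N ->
  `|\sum_a psi (c * a) * eta (l a)| <= kappa%:R * sqrtC #|K|%:R.
Proof.
move=> lD lK.
have nzQ: #|K|%:R != 0 :> algC by rewrite pnatr_eq0 -lt0n ltnW ?finNzRing_gt1.
pose D := [set t | [forall a, psi (c * a + t * l a) == 1]].
have AE t: \sum_a psi (c * a + t * l a) = if t \in D then #|K|%:R else 0.
  rewrite (sum_characterT (chi := fun a => psi (c * a + t * l a))) ?inE // => x y.
  by rewrite lD !mulrDr addrACA psiD.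
have l0: l 0 = 0 by apply: (addIr (l 0)); rewrite -lD !add0r.
have lN x: l (- x) = - l x by apply: (addIr (l x)); rewrite -lD !addNr.
(* Fourier inversion: [#|K| * eta (l a)] is the sum over [t] of [psi (t * l a) * gauss (- t)]. *)
have sumE: \sum_a psi (c * a) * eta (l a) = \sum_(t in D) gauss (- t).
  apply: (mulfI nzQ); rewrite mulr_sumr.
  have: \sum_t (\sum_a psi (c * a + t * l a)) * gauss (- t)
      = \sum_(a : K) #|K|%:R * (psi (c * a) * eta (l a)).
    under eq_bigr do rewrite mulr_suml.
    rewrite exchange_big; apply: eq_bigr => a _ /=.
    under eq_bigr do rewrite mulr_sumr.
    rewrite exchange_big /= (bigD1 (l a)) //= [X in _ + X]big1 ?addr0 => [|b nb].
      under eq_bigr do rewrite mulrCA -psiD mulNr addrK.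
      by rewrite sumr_const [RHS]mulr_natl mulrC.
    under eq_bigr do rewrite mulrCA -psiD mulNr -addrA -mulrBr psiD mulrA.
    by rewrite -mulr_sumr sum_psi subr_eq0 eq_sym (negPf nb) mulr0.
  move <-; rewrite mulr_sumr [RHS]big_mkcond; apply: eq_bigr => t _; rewrite AE.
  by case: ifP; rewrite ?mul0r.
(* Two elements of [D] differ by an element of the annihilator of the image of [l], which has order
   [kappa]. *)
have cardD: (#|D| <= kappa)%N.
  pose U := l @: K; have U0: 0 \in U by apply/imsetP; exists 0; rewrite ?l0.
  have UD: {in U &, forall x y, x + y \in U}.
    by move=> _ _ /imsetP[x _ ->] /imsetP[y _ ->]; rewrite -lD imset_f.
  have UN: {in U, forall x, - x \in U} by move=> _ /imsetP[x _ ->]; rewrite -lN imset_f.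
  have ->: kappa = #|psi_ann U|.
    apply/eqP; rewrite -(eqn_pmul2l (_ : 0 < #|U|)%N) ?lK ?card_psi_ann //.
    by apply/card_gt0P; exists 0.
  have [->|[t0 Dt0]] := set_0Vmem D; first by rewrite cards0.
  rewrite -[#|D|](card_imset _ (addIr (- t0))).
  apply/subset_leq_card/subsetP => _ /imsetP[t Dt ->].
  apply/psi_annP => _ /imsetP[a _ ->]; move: Dt Dt0; rewrite !inE.
  move=> /forallP/(_ a)/eqP pt /forallP/(_ a)/eqP pt0.
  have ->: (t - t0) * l a = (c * a + t * l a) - (c * a + t0 * l a).
    by rewrite opprD addrACA subrr add0r mulrBl.
  by rewrite psiD pt psiN pt0 conjC1 mulr1.
rewrite sumE; apply: le_trans (ler_norm_sum _ _ _) _.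
apply: (@le_trans _ _ (\sum_(t in D) sqrtC #|K|%:R)).
  by apply: ler_sum => t _; apply: norm_gauss_le.
by rewrite sumr_const -[leLHS]mulr_natl ler_wpM2r ?sqrtC_ge0 ?ler0n // ler_nat.
Qed.

End GaussSum.
End AdditiveCharacter.

(** * Primitive elements *)

Lemma theta_primes (N : nat) : (0 < N)%N ->
  (totient N)%:R / N%:R = \prod_(l <- primes N) (1 - l%:R^-1) :> algC.
Proof.
move=> N_gt0; rewrite totientE // {3}(prod_prime_decomp N_gt0) prime_decompE big_map /=.
rewrite !natr_prod -prodf_div; apply: eq_big_seq => l; rewrite mem_primes => /and3P[l_pr _ l_dvd].
have nzl: l%:R != 0 :> algC by rewrite pnatr_eq0 -lt0n prime_gt0.
have e_gt0: (0 < logn l N)%N by rewrite logn_gt0 mem_primes l_pr N_gt0.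
rewrite -{2}(prednK e_gt0) expnS !natrM -mulf_div divff ?mulr1; last first.
  by rewrite natrX expf_neq0.
by rewrite -subn1 natrB ?prime_gt0 // mulrBl mulfV // mul1r.
Qed.

Lemma coprime_primes (N i : nat) : (0 < N)%N ->
  (coprime N i)%:R = \prod_(l <- primes N) (1 - (l %| i)%:R) :> algC.
Proof.
move=> N_gt0; have [N_co|] := boolP (coprime N i).
  rewrite big1_seq // => l /=; rewrite mem_primes => /and3P[l_pr _ l_dvd].
  case: (boolP (l %| i)%N) => [li|]; rewrite ?subr0 //.
  have: (l %| gcdn N i)%N by rewrite dvdn_gcd l_dvd.
  by rewrite (eqP N_co) dvdn1 => /eqP l1; rewrite l1 in l_pr.
move=> nco; have g1: (1 < gcdn N i)%N by rewrite ltn_neqAle eq_sym nco gcdn_gt0 N_gt0.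
have p_pr := pdiv_prime g1; have := pdiv_dvd (gcdn N i); rewrite dvdn_gcd => /andP[pN pi].
have p_in: pdiv (gcdn N i) \in primes N by rewrite mem_primes p_pr N_gt0.
by rewrite (big_rem _ p_in) /= pi subrr mul0r.
Qed.

(** * Characters of the integers modulo [N] and the indicator of coprimality *)

Section CyclicCharacters.
Variables (N' : nat) (omega : algC).
Local Notation N := N'.+1.
Hypothesis omega_prim : N.-primitive_root omega.

(** The multiplicative character of index [j], read on a discrete logarithm [i]. Taking [N] as a
    successor makes ['I_N] an additive group, here the dual group. *)
Definition cyc_char (j : 'I_N) (i : nat) : algC := omega ^+ (j * i).

Lemma cyc_char0 i : cyc_char 0 i = 1.
Proof. by rewrite /cyc_char mul0n expr0. Qed.

Lemma cyc_charD j k i : cyc_char (j + k) i = cyc_char j i * cyc_char k i.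
Proof.
rewrite /cyc_char -exprD -mulnDl; apply/eqP.
by rewrite (eq_prim_root_expr omega_prim) /= modnMml.
Qed.

Lemma cyc_char_eq1 j i : (cyc_char j i == 1) = (N %| j * i)%N.
Proof. by rewrite /cyc_char (prim_order_dvd omega_prim). Qed.

Definition torsion (l : nat) : {set 'I_N} := [set j : 'I_N | (N %| l * j)%N].

Lemma card_torsion l : (0 < l)%N -> (l %| N)%N -> #|torsion l| = l.
Proof.
move=> l_gt0 lN; have N_E: (N %/ l * l = N)%N := divnK lN.
have d_gt0: (0 < N %/ l)%N by rewrite divn_gt0 // dvdn_leq.
pose h (m : 'I_l) : 'I_N := inord (m * (N %/ l)).
have hE m: h m = (m * (N %/ l))%N :> nat.
  by rewrite inordK // -[X in (_ < X)%N]N_E mulnC ltn_pmul2l.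
have h_inj: injective h.
  by move=> m m' /(congr1 val); rewrite /= !hE => /eqP; rewrite eqn_pmul2r // => /eqP/val_inj.
rewrite -[RHS]card_ord -(card_imset _ h_inj); apply: eq_card => j.
rewrite inE; apply/idP/imsetP => [Nlj|[m _ ->]]; last first.
  by rewrite hE mulnCA [X in (_ * X)%N]mulnC N_E dvdn_mull.
have dj: (N %/ l %| j)%N by move: Nlj; rewrite -{1}N_E mulnC dvdn_pmul2l.
have m_lt: (j %/ (N %/ l) < l)%N by rewrite ltn_divLR // mulnC N_E.
by exists (Ordinal m_lt) => //; apply: val_inj; rewrite /= hE /= divnK.
Qed.

(** Orthogonality over the [l] characters of order dividing [l]: all are 1 at [i] exactly when [l]
    divides [i], and the index [N %/ l] alone decides this. *)
Lemma dvdn_torsion l i : (1 < l)%N -> (l %| N)%N ->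
  (l %| i)%N%:R = (#|torsion l|%:R)^-1 * \sum_(j in torsion l) cyc_char j i.
Proof.
move=> l_gt1 lN; have l_gt0 := ltnW l_gt1; have N_E: (N %/ l * l = N)%N := divnK lN.
rewrite (@sum_character _ (torsion l) (cyc_char^~ i)); first last.
- by move=> j k; rewrite cyc_charD.
- move=> j; rewrite !inE /= => Nlj.
  rewrite /dvdn modnMmr -/(dvdn _ _) mulnBr.
  by apply: dvdn_sub => //; apply: dvdn_mull.
- by move=> j k; rewrite !inE /= => Nj Nk; rewrite /dvdn modnMmr mulnDr; apply: dvdn_add.
have nzl: #|torsion l|%:R != 0 :> algC by rewrite card_torsion // pnatr_eq0 -lt0n.
suff ->: [forall j in torsion l, cyc_char j i == 1] = (l %| i)%N.
  by case: (l %| i)%N; rewrite ?mulVf // mulr0.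
have d_gt0: (0 < N %/ l)%N by rewrite divn_gt0 // dvdn_leq.
apply/forall_inP/idP => [h|li j].
  have d_lt: (N %/ l < N)%N by rewrite ltn_Pdiv.
  have := h (Ordinal d_lt); rewrite inE cyc_char_eq1 /= mulnC N_E dvdnn => /(_ isT).
  by rewrite -{1}N_E dvdn_pmul2l.
by rewrite inE cyc_char_eq1 mulnC => Nlj; apply: dvdn_trans Nlj _; apply: dvdn_mul.
Qed.

Lemma coprime_fourier : exists c : 'I_N -> algC,
  [/\ forall i, (coprime N i)%:R = \sum_j c j * cyc_char j i,
      c 0 = (totient N)%:R / N%:R
    & \sum_(j | j != 0) `|c j| <= (totient N)%:R / N%:R * (2 ^ size (primes N) - 1)%:R].
Proof.
have: fourier_bound cyc_char (fun i => \prod_(l <- primes N) (1 - (l %| i)%N%:R))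
         (\prod_(l <- primes N) (2%:R * (1 - l%:R^-1))).
  apply: (fourier_bound_prod cyc_char0 cyc_charD) => l.
  rewrite mem_primes => /and3P[l_pr _ lN]; rewrite -{2}(card_torsion (prime_gt0 l_pr) lN).
  apply: (fourier_bound_complement cyc_char0) => [|i]; first by rewrite inE muln0.
  by rewrite (dvdn_torsion _ (prime_gt1 l_pr)).
case=> c cE cr; have copE i: (coprime N i)%:R = \sum_j c j * cyc_char j i.
  by rewrite coprime_primes.
(* The coefficients come from an existential, so [c 0] is recovered by averaging over a period,
   which kills every other character. *)
have c0: c 0 = (totient N)%:R / N%:R.
  have nzN: N%:R != 0 :> algC by rewrite pnatr_eq0.
  apply: (mulIf nzN); rewrite divfK // totient_count_coprime big_mkord natr_sum.
  under [RHS]eq_bigr do rewrite copE.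
  rewrite exchange_big (bigD1 0) //= [X in _ + X]big1 ?addr0 => [|j nzj].
    by under eq_bigr do rewrite cyc_char0 mulr1; rewrite sumr_const card_ord mulr_natr.
  rewrite -mulr_sumr (@sum_characterT 'I_N (fun i : 'I_N => cyc_char j i)); last first.
    move=> i k; rewrite /cyc_char -exprD -mulnDr; apply/eqP.
    by rewrite (eq_prim_root_expr omega_prim) /= modnMmr.
  case: forallP => [h|_]; last by rewrite mulr0.
  have j_gt0: (0 < j)%N by rewrite lt0n.
  have N_gt1: (1 < N)%N := leq_ltn_trans j_gt0 (ltn_ord j).
  have := h (Ordinal N_gt1); rewrite cyc_char_eq1 muln1 => /(dvdn_leq j_gt0).
  by rewrite leqNgt ltn_ord.
(* The total mass is at most [2 ^ size (primes N)] times [totient N / N]; removing [c 0] accounts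
   for the [- 1]. *)
exists c; split=> //; move: cr; rewrite (bigD1 0) //= c0.
rewrite ger0_norm ?divr_ge0 ?ler0n // big_split /= -theta_primes //.
rewrite big_const_seq count_predT iter_mulr_1.
rewrite -natrX natrB ?expn_gt0 // mulrBr mulr1 lerBrDl natrX.
by rewrite [2%:R ^+ _ * _]mulrC.
Qed.

End CyclicCharacters.

(** A generator turns products into sums modulo [N] and primitivity into coprimality. The element of
    logarithm 1 serves to separate the characters. *)
Lemma exists_discrete_log (K : finFieldType) (N : nat) : #|K| = N.+1 ->
  exists log : K -> nat,
  [/\ forall x y : K, x != 0 -> y != 0 -> log (x * y) = log x + log y %[mod N],
      forall x : K, x != 0 -> N.-primitive_root x = coprime N (log x)
    & exists2 x : K, x != 0 & log x = 1 %[mod N]].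
Proof.
move=> KN; have N_gt0: (0 < N)%N by have:= finNzRing_gt1 K; rewrite KN.
have unity (x : K) : x != 0 -> x ^+ N = 1.
  by move=> nzx; apply: (mulfI nzx); rewrite -exprS -KN expf_card mulr1.
have: has N.-primitive_root (enum [pred x : K | x != 0]).
  apply: cyclic.has_prim_root => //; rewrite ?enum_uniq // -?cardE ?cardC1 ?KN //.
  by apply/allP => x; rewrite mem_enum inE => /unity/eqP; rewrite unity_rootE.
case/hasP=> g _ g_prim.
(* The implication holds vacuously at 0, so [log] is total with an arbitrary value there. *)
have logP (x : K) : exists i : 'I_N, (x != 0) ==> (x == g ^+ i).
  have [->|nzx] := eqVneq x 0; first by exists (Ordinal N_gt0).
  by have [i ->] := prim_rootP g_prim (unity x nzx); exists i; rewrite eqxx.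
pose log x : 'I_N := xchoose (logP x).
have logE x : x != 0 -> x = g ^+ log x.
  by move=> nzx; apply/eqP/(implyP (xchooseP (logP x))).
have nzg: g != 0 by rewrite (prim_root_eq0 g_prim) -lt0n.
exists log; split=> [x y nzx nzy|x nzx|].
- apply/eqP; rewrite -(eq_prim_root_expr g_prim) exprD -!logE //.
  by rewrite mulf_neq0.
- by rewrite {1}(logE x nzx) prim_root_exp_coprime // coprime_sym.
by exists g => //; apply/eqP; rewrite -(eq_prim_root_expr g_prim) -logE // expr1.
Qed.

(** * Counting primitive values of an additive map *)

Section PrimitiveValues.
Variables (K : finFieldType) (psi : K -> algC).
Hypothesis psiD : {morph psi : x y / x + y >-> x * y}.
Hypothesis psi_norm : forall x, `|psi x| = 1.
Hypothesis psi_nontriv : exists x, psi x != 1.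

(** Primitivity of [l a] is expanded in multiplicative characters: the trivial one gives the main
    term, and each other is a mixed sum once [S] is expanded additively at cost [r]. *)
Lemma card_primitive_values (N : nat) (S : {set K}) (l : K -> K) (kappa : nat) (r : algC) :
    #|K| = N.+1 -> {morph l : x y / x + y} -> (#|l @: K| * kappa = #|K|)%N ->
    {in S, forall a, l a != 0} ->
    fourier_bound (fun c a => psi (c * a)) (fun a => (a \in S)%:R) r ->
  `| #|[set a in S | N.-primitive_root (l a)]|%:R - (totient N)%:R / N%:R * #|S|%:R |
     <= (totient N)%:R / N%:R * (2 ^ size (primes N) - 1)%:R * (r * (kappa%:R * sqrtC #|K|%:R)).
Proof.
move=> KN lD lK Sl [d dE dr].
case: N KN => [|N'] KN; first by have:= finNzRing_gt1 K; rewrite KN.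
have [omega omega_prim] := C_prim_root_exists (ltn0Sn N').
have [c [cE c0 cr]] := coprime_fourier omega_prim.
have [log [logM log_prim [g nzg log_g]]] := exists_discrete_log KN.
(* Extension by 0 at 0, for the trivial character too; the latter is still 1 on [l a] for [a] in
   [S]. *)
pose eta (j : 'I_N'.+1) (x : K) : algC := if x == 0 then 0 else cyc_char omega j (log x).
have eta_modE j x i : x != 0 -> log x = i %[mod N'.+1] -> eta j x = cyc_char omega j i.
  move=> nzx e; rewrite /eta (negPf nzx); apply/eqP; rewrite (eq_prim_root_expr omega_prim).
  by rewrite -modnMmr e modnMmr.
have etaM j: {morph eta j : x y / x * y}.
  move=> x y; have [->|nzx] := eqVneq x 0; first by rewrite /eta mul0r eqxx mul0r.
  have [->|nzy] := eqVneq y 0; first by rewrite /eta mulr0 eqxx mulr0.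
  rewrite (eta_modE _ _ _ _ (logM x y nzx nzy)) ?mulf_neq0 //.
  by rewrite /eta (negPf nzx) (negPf nzy) /cyc_char mulnDr exprD.
have eta_norm j x: x != 0 -> `|eta j x| = 1.
  move=> nzx; rewrite /eta (negPf nzx) normrX.
  have /eqP->: `|omega| == 1; last by rewrite expr1n.
  by rewrite -(@pexpr_eq1 _ _ N'.+1) // -normrX (prim_expr_order omega_prim) normr1.
have mixed j : j != 0 -> `|\sum_(a in S) eta j (l a)| <= r * (kappa%:R * sqrtC #|K|%:R).
  move=> nzj; have ->: \sum_(a in S) eta j (l a) = \sum_c d c * \sum_a psi (c * a) * eta j (l a).
    under [RHS]eq_bigr do rewrite mulr_sumr.
    rewrite exchange_big big_mkcond; apply: eq_bigr => a _ /=.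
    under eq_bigr do rewrite mulrA.
    by rewrite -mulr_suml -dE; case: (a \in S); rewrite ?mul1r ?mul0r.
  apply: le_trans (ler_norm_sum _ _ _) _.
  apply: le_trans (ler_wpM2r _ dr); last by rewrite mulr_ge0 ?sqrtC_ge0 ?ler0n.
  rewrite mulr_suml; apply: ler_sum => t _; rewrite normrM ler_wpM2l //.
  apply: (norm_mixed_sum_le psiD psi_norm psi_nontriv) => //.
  - by rewrite /eta eqxx.
  - exact: eta_norm.
  (* At logarithm 1 the value is [omega ^+ j], which is not 1 because [0 < j < N]. *)
  exists g => //; rewrite (eta_modE _ _ _ nzg log_g) cyc_char_eq1 // muln1.
  have j_gt0: (0 < j)%N by rewrite lt0n.
  by apply/negP => /(dvdn_leq j_gt0); rewrite leqNgt ltn_ord.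
have ->: #|[set a in S | N'.+1.-primitive_root (l a)]|%:R = \sum_j c j * \sum_(a in S) eta j (l a).
  under [RHS]eq_bigr do rewrite mulr_sumr.
  rewrite exchange_big -sum1_card natr_sum big_mkcond [RHS]big_mkcond /=.
  apply: eq_bigr => a _; rewrite inE; case Sa: (a \in S) => //=.
  have nzl := Sl a Sa; rewrite (log_prim _ nzl).
  under eq_bigr do rewrite /eta (negPf nzl).
  by rewrite -cE; case: (coprime _ _).
rewrite (bigD1 0) //= c0 (eq_bigr (fun=> 1)) => [|a Sa]; last first.
  by rewrite /eta (negPf (Sl a Sa)) cyc_char0.
rewrite sumr_const addrAC subrr add0r.
apply: le_trans (ler_norm_sum _ _ _) _.
apply: le_trans (ler_wpM2r _ cr); last first.
  by rewrite mulr_ge0 ?mulr_ge0 ?sqrtC_ge0 ?ler0n //; apply: le_trans dr; apply: sumr_ge0.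
by rewrite mulr_suml; apply: ler_sum => j nzj; rewrite normrM ler_wpM2l // mixed.
Qed.

End PrimitiveValues.

(** * Linearized polynomials *)

Section Linearized.
Variables (F : finFieldType) (L : fieldExtType F).
Local Notation q := #|F|.
Local Notation n := (\dim {:L}).
Implicit Types (f g : {poly F}) (a b : L).

Lemma card_finvect : #|finvect_type L| = (q ^ n)%N.
Proof. by rewrite -(card_vspacef (Vector.class (finvect_type L))) card_vspace. Qed.

Lemma frobeniusD i a b : (a + b) ^+ (q ^ i) = a ^+ (q ^ i) + b ^+ (q ^ i).
Proof.
have [p p_pr p_char] := finPcharP F.
apply: exprDn_pchar; rewrite (eq_pnat _ (pchar_lalg L)) pnatX.
by rewrite (card_pprimeChar p_char : #|F| = _) pnatX (pnatE _ p_pr) p_char.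
Qed.

Lemma frobeniusZ i c a : (c *: a) ^+ (q ^ i) = c *: a ^+ (q ^ i).
Proof.
rewrite exprZn; congr (_ *: _); elim: i => [|i IHi]; first by rewrite expr1.
by rewrite expnSr exprM IHi expf_card.
Qed.

Lemma frobenius_dim a : a ^+ (q ^ n) = a.
Proof. by rewrite -card_finvect; apply: (@expf_card (finvect_type L)). Qed.

Lemma q_assoc_widen N f a : (size f <= N)%N ->
  q_assoc f a = \sum_(i < N) f`_i *: a ^+ (q ^ i).
Proof.
move=> le_fN; rewrite /q_assoc (big_ord_widen N (fun i => f`_i *: a ^+ (q ^ i))) //.
rewrite big_mkcond; apply: eq_bigr => i _; case: ltnP => // /(nth_default 0)->.
by rewrite scale0r.
Qed.

Lemma q_assoc_is_linear f : linear (q_assoc f : L -> L).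
Proof.
move=> c a b; rewrite /q_assoc scaler_sumr -big_split; apply: eq_bigr => i _ /=.
by rewrite frobeniusD frobeniusZ scalerDr !scalerA mulrC.
Qed.
HB.instance Definition _ f :=
  GRing.isLinear.Build F L L *:%R (q_assoc f : L -> L) (q_assoc_is_linear f).

Lemma q_assocD f g a : q_assoc (f + g) a = q_assoc f a + q_assoc g a.
Proof.
rewrite (q_assoc_widen a (size_polyD f g)) (q_assoc_widen a (leq_maxl (size f) (size g))).
rewrite (q_assoc_widen a (leq_maxr (size f) (size g))) -big_split.
by apply: eq_bigr => i _; rewrite coefD scalerDl.
Qed.

Lemma q_assoc0 a : q_assoc 0 a = 0.
Proof. by rewrite /q_assoc size_poly0 big_ord0. Qed.

Lemma q_assocZ c f a : q_assoc (c *: f) a = c *: q_assoc f a.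
Proof.
rewrite (q_assoc_widen a (size_scale_leq c f)) scaler_sumr.
by apply: eq_bigr => i _; rewrite coefZ scalerA.
Qed.

Lemma q_assocB f g a : q_assoc (f - g) a = q_assoc f a - q_assoc g a.
Proof. by rewrite -scaleN1r q_assocD q_assocZ scaleN1r. Qed.

Lemma q_assocMX f a : q_assoc (f * 'X) a = q_assoc f (a ^+ q).
Proof.
rewrite (q_assoc_widen (N := (size f).+1)); last first.
  by rewrite (leq_trans (size_polyMleq _ _)) // size_polyX addn2.
rewrite big_ord_recl coefMX scale0r add0r; apply: eq_bigr => i _.
by rewrite coefMX /= -exprM -expnS.
Qed.

Lemma q_assoc_frobenius f a : q_assoc f (a ^+ q) = q_assoc f a ^+ q.
Proof.
have qD: {morph (fun x : L => x ^+ q) : x y / x + y}.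
  by move=> x y; have:= frobeniusD 1 x y; rewrite expn1.
have q0: (0 : L) ^+ q = 0 by rewrite expr0n -(prednK (ltnW (finNzRing_gt1 F))).
rewrite [RHS](big_morph _ qD q0); apply: eq_bigr => i _.
by have:= frobeniusZ 1 f`_i (a ^+ (q ^ i)); rewrite expn1 => ->; rewrite -!exprM mulnC.
Qed.

(** This makes [L] a module over [F[x]] in which ['X] acts as the Frobenius map. *)
Lemma q_assocM f g a : q_assoc (f * g) a = q_assoc f (q_assoc g a).
Proof.
elim/poly_ind: f g a => [|f c IHf] g a; first by rewrite mul0r !q_assoc0.
rewrite mulrDl q_assocD -mulrA [_ * g]mulrC IHf q_assocMX q_assoc_frobenius.
rewrite q_assocD q_assocMX mul_polyC q_assocZ; congr (_ + _).
by rewrite -[c%:P]mulr1 mul_polyC q_assocZ /q_assoc size_poly1 big_ord1 coef1 scale1r expr1.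
Qed.

Lemma q_assocXn_sub1 a : q_assoc ('X^n - 1) a = 0.
Proof.
have XnE m : q_assoc 'X^m a = a ^+ (q ^ m).
  elim: m a => [|m IHm] a; first by rewrite /q_assoc size_poly1 big_ord1 coef1 scale1r.
  by rewrite exprSr q_assocMX IHm -exprM expnS.
by rewrite q_assocB XnE -(expr0 'X) XnE frobenius_dim expr1 subrr.
Qed.

Lemma q_assoc_dvdp f g a : f %| g -> q_assoc f a = 0 -> q_assoc g a = 0.
Proof. by case/dvdpP=> h -> f0; rewrite q_assocM f0 linear0. Qed.

(** The kernel has [q ^ dim] elements, all roots of the [q]-associate [p], whose degree is
    [q ^ k]. *)
Lemma dim_ker_q_assoc_le f k : size f = k.+1 -> (\dim (lker (linfun (q_assoc f : L -> L))) <= k)%N.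
Proof.
move=> fk; set V := lker _.
pose p : {poly L} := \sum_(i < k.+1) (f`_i)%:A *: 'X^(q ^ i).
have q_gt1 := finNzRing_gt1 F.
have nzfk: f`_k != 0 by have := lead_coef_eq0 f; rewrite lead_coefE fk /= -size_poly_eq0 fk => ->.
have sp: size p = (q ^ k).+1.
  have sk: size ((f`_k)%:A *: 'X^(q ^ k) : {poly L}) = (q ^ k).+1.
    by rewrite size_scale ?size_polyXn // scaler_eq0 negb_or nzfk oner_neq0.
  rewrite /p big_ord_recr /= addrC size_polyDl sk // ltnS.
  apply: (leq_trans (size_sum _ _ _)); apply/bigmax_leqP => i _.
  by rewrite (leq_trans (size_scale_leq _ _)) // size_polyXn ltn_exp2l.
have nzp: p != 0 by rewrite -size_poly_eq0 sp.
have root_p : all (root p) (enum (mem (V : {vspace finvect_type L}))).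
  apply/allP => x; rewrite (@mem_enum (finvect_type L)) => Vx; rewrite rootE horner_sum.
  have := Vx; rewrite memv_ker lfunE /= /q_assoc fk => /eqP fx; apply/eqP.
  rewrite -[RHS]fx; apply: eq_bigr => i _.
  by rewrite hornerZ hornerXn mulr_algl.
have := max_poly_roots nzp root_p (enum_uniq _).
by rewrite -(@cardE (finvect_type L)) card_vspace sp ltnS leq_exp2l.
Qed.

Lemma size_Xn_sub1 : size ('X^n - 1 : {poly F}) = n.+1.
Proof. by rewrite size_XnsubC ?adim_gt0. Qed.

Lemma Xn_sub1_neq0 : 'X^n - 1 != 0 :> {poly F}.
Proof. by rewrite -size_poly_eq0 size_Xn_sub1. Qed.

(** With [h] the cofactor of [f], the image of [L_h] lies in the kernel of [L_f] and has dimension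
    at least [n - deg h = k]. *)
Lemma dim_ker_q_assoc f k : f %| 'X^n - 1 -> size f = k.+1 ->
  \dim (lker (linfun (q_assoc f : L -> L))) = k.
Proof.
move=> fT fk; apply/eqP; rewrite eqn_leq dim_ker_q_assoc_le //=.
have [h hE] := dvdpP _ _ fT; rewrite mulrC in hE.
have nzf: f != 0 by rewrite -size_poly_eq0 fk.
have nzh: h != 0 by apply: contraNneq Xn_sub1_neq0 => h0; rewrite hE h0 mulr0.
have hk: size h = (size h).-1.+1 by rewrite prednK // size_poly_gt0.
have: (k + (size h).-1 = n)%N.
  by apply: succn_inj; rewrite -size_Xn_sub1 hE size_mul // fk addSn -addnS -hk.
have: (limg (linfun (q_assoc h : L -> L)) <= lker (linfun (q_assoc f : L -> L)))%VS.
  apply/subvP => _ /memv_imgP[x _ ->]; rewrite memv_ker !lfunE /= -q_assocM -hE.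
  by rewrite q_assocXn_sub1.
move/dimvS; have := limg_ker_dim (linfun (q_assoc h : L -> L)) fullv.
rewrite capfv; have := dim_ker_q_assoc_le hk; set dh := \dim (lker _); set dl := \dim (limg _).
move=> le1 e1 le2 e2; rewrite -(leq_add2r (size h).-1) e2 -e1 addnC leq_add //.
Qed.

Lemma dim_img_q_assoc f k : f %| 'X^n - 1 -> size f = k.+1 ->
  (\dim (limg (linfun (q_assoc f : L -> L))) + k = n)%N.
Proof.
move=> fT fk; rewrite -[X in (_ + X)%N](dim_ker_q_assoc fT fk) addnC.
by rewrite -(limg_ker_dim (linfun (q_assoc f : L -> L)) fullv) capfv.
Qed.

(** A linear relation among the conjugates is a polynomial of size at most [n] killing [a], and any
    annihilator reduces to such a one modulo ['X^n - 1]. *)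
Lemma normal_eltP a : reflect (forall g, q_assoc g a = 0 -> 'X^n - 1 %| g) (normal_elt a).
Proof.
have sz: size (conjs a) == n by rewrite size_map size_iota.
have nthE (i : 'I_n) : (Tuple sz)`_i = a ^+ (q ^ i).
  by rewrite /= (nth_map 0%N) ?size_iota // nth_iota.
have ->: normal_elt a = free (Tuple sz).
  by rewrite /normal_elt basisEfree subvf (eqP sz) leqnn !andbT.
apply: (iffP freeP) => [fr g g0|ann c c0 i].
  have r0: q_assoc (g %% ('X^n - 1)) a = 0.
    have := divp_eq g ('X^n - 1) => /(congr1 (fun h => q_assoc h a)).
    by rewrite g0 q_assocD q_assocM q_assocXn_sub1 linear0 add0r.
  have szr: (size (g %% ('X^n - 1))%R <= n)%N.
    by rewrite -ltnS -size_Xn_sub1 ltn_modp Xn_sub1_neq0.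
  rewrite /dvdp; apply/eqP/polyP => i; rewrite coef0.
  have [lt_in|le_ni] := ltnP i n; last by rewrite nth_default // (leq_trans szr).
  rewrite (q_assoc_widen _ szr) in r0.
  apply: (fr (fun i : 'I_n => (g %% ('X^n - 1))`_i) _ (Ordinal lt_in)).
  by rewrite -[RHS]r0; apply: eq_bigr => j _; rewrite nthE.
pose g := \poly_(j < n) (if insub j is Some j' then c j' else 0).
have gE (j : 'I_n) : g`_j = c j by rewrite coef_poly ltn_ord valK.
have szg: (size g <= n)%N := size_poly _ _.
have: q_assoc g a = 0.
  by rewrite (q_assoc_widen _ szg) -[RHS]c0; apply: eq_bigr => j _; rewrite gE nthE.
move/ann=> Tg; rewrite -gE; suff ->: g = 0 by rewrite coef0.
apply: contraTeq Tg => nzg; apply/negP => /(dvdp_leq nzg).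
by rewrite size_Xn_sub1 leqNgt ltnS szg.
Qed.

(** If [d] is the gcd of [g] and ['X^n - 1], the quotient by [d] kills [L_g(a)], so normality forces
    [d] to be constant. Conversely a coprime [g] cancels by Gauss. *)
Lemma normal_elt_q_assoc a g : normal_elt a ->
  normal_elt (q_assoc g a) = coprimep ('X^n - 1) g.
Proof.
move=> /normal_eltP na; apply/normal_eltP/idP => [ann|co h]; last first.
  by rewrite -q_assocM => /na; rewrite Gauss_dvdpl.
pose d := gcdp ('X^n - 1) g.
have [dT dg] : d %| 'X^n - 1 /\ d %| g by rewrite dvdp_gcdl dvdp_gcdr.
have nzd: d != 0 by rewrite gcdp_eq0 negb_and Xn_sub1_neq0.
have TE := divpK dT.
have nzTd: ('X^n - 1) %/ d != 0.
  by apply: contraNneq Xn_sub1_neq0 => Td0; rewrite -TE Td0 mul0r.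
have: 'X^n - 1 %| ('X^n - 1) %/ d.
  apply: ann; rewrite -q_assocM; apply: q_assoc_dvdp (q_assocXn_sub1 _).
  by rewrite -{1}TE dvdp_mul2l.
by rewrite -{1}TE -[X in _ %| X]mulr1 dvdp_mul2l // dvdp1.
Qed.

End Linearized.

(** * Squarefree divisors and sieving *)

Section SubProducts.
Variables (T : eqType) (op : T -> T -> T) (idx : T).

(** One product per subsequence. Abstracting [op] serves integers and polynomials alike: over
    distinct primes these are distinct squarefree divisors, hence [2^omega <= W]. *)
Definition subprods (s : seq T) : seq T :=
  foldr (fun x l => l ++ map (op x) l) [:: idx] s.

Lemma size_subprods s : size (subprods s) = (2 ^ size s)%N.
Proof. by elim: s => //= x s IHs; rewrite size_cat size_map IHs addnn -mul2n -expnS. Qed.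

Lemma mem_subprods s y : y \in subprods s ->
  exists2 t, subseq t s & y = \big[op/idx]_(x <- t) x.
Proof.
elim: s y => [|x s IHs] y /=; first by rewrite inE => /eqP->; exists [::]; rewrite ?big_nil.
rewrite mem_cat => /orP[/IHs[t ts ->]|/mapP[z /IHs[t ts ->] ->]].
  by exists t => //; apply: subseq_trans ts (subseq_cons _ _).
by exists (x :: t); rewrite ?big_cons //= eqxx.
Qed.

(** The products that use the head are divisible by it and the others are not, so the two halves of
    the list are disjoint. *)
Lemma subprods_uniq (dvd : rel T) s :
    {in s, forall x, injective (op x)} -> (forall x y, dvd x (op x y)) ->
    {in s, forall x t, subseq t s -> dvd x (\big[op/idx]_(y <- t) y) = (x \in t)} ->
  uniq s -> uniq (subprods s).
Proof.
move=> op_inj dvd_op; elim: s op_inj => //= x s IHs op_inj dvdE /andP[x_s s_uniq].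
have sx: subseq s (x :: s) := subseq_cons s x.
have {}IHs: uniq (subprods s).
  apply: IHs => // [y ys|y ys t ts]; first by apply: op_inj; rewrite in_cons ys orbT.
  by apply: dvdE (subseq_trans ts sx); rewrite in_cons ys orbT.
rewrite cat_uniq IHs map_inj_uniq ?IHs ?andbT; last by apply: op_inj; rewrite mem_head.
apply/hasPn => _ /mapP[z _ ->]; apply/negP => /mem_subprods[t ts xzE].
have := dvdE x (mem_head _ _) t (subseq_trans ts sx); rewrite -xzE dvd_op => /esym xt.
by rewrite (mem_subseq ts xt) in x_s.
Qed.

End SubProducts.

Lemma prime_dvd_prod_primes (p : nat) (t : seq nat) :
  prime p -> all prime t -> (p %| \prod_(l <- t) l)%N = (p \in t).
Proof.
move=> p_pr; elim: t => [_|l t IHt /= /andP[l_pr /IHt{}IHt]].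
  by rewrite big_nil dvdn1; case: p p_pr => [|[]].
by rewrite big_cons Euclid_dvdM // IHt in_cons dvdn_prime2.
Qed.

Lemma Wnat_ge (N : nat) : (0 < N)%N -> (2 ^ size (primes N) <= Wnat N)%N.
Proof.
move=> N_gt0; rewrite -(size_subprods muln 1%N) /Wnat -size_filter.
have primes_prime t : subseq t (primes N) -> all prime t.
  by move=> ts; apply/allP => p /(mem_subseq ts); rewrite mem_primes => /andP[].
apply: uniq_leq_size => [|m /mem_subprods[t ts ->]].
  apply: (@subprods_uniq _ _ _ dvdn) (primes_uniq N) => [p|p m|p pN t ts].
  - rewrite mem_primes => /andP[p_pr _] m m' /eqP.
    by rewrite eqn_pmul2l ?prime_gt0 // => /eqP.
  - exact: dvdn_mulr.
  by rewrite prime_dvd_prod_primes ?primes_prime //; move: pN; rewrite mem_primes => /andP[].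
have t_pr := primes_prime t ts; have t_uniq := subseq_uniq ts (primes_uniq N).
have m_gt0: (0 < \prod_(l <- t) l)%N.
  by rewrite big_seq prodn_cond_gt0 // => l /(allP t_pr)/prime_gt0.
rewrite mem_filter -dvdn_divisors // /sqfree_nat m_gt0 /=; apply/andP; split.
  apply/forallP => d; apply/implyP => d_gt1; apply/negP => dd.
  (* The prime [p] occurs once in [t]; after cancelling it, [p] would divide a product of other
     primes. *)
  have p_pr := pdiv_prime d_gt1; set p := pdiv d in p_pr.
  have pp: (p * p %| \prod_(l <- t) l)%N by apply: dvdn_trans dd; apply: dvdn_mul; apply: pdiv_dvd.
  have pt: p \in t by rewrite -prime_dvd_prod_primes //; apply: dvdn_trans pp; apply: dvdn_mulr.
  move: pp; rewrite (perm_big _ (perm_to_rem pt)) big_cons dvdn_pmul2l ?prime_gt0 //=.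
  rewrite prime_dvd_prod_primes ?mem_rem_uniqF //.
  by apply/allP => l /mem_rem/(allP t_pr).
elim: t ts t_pr t_uniq {m_gt0} => [|l t IHt] ts; first by rewrite big_nil dvd1n.
rewrite /= big_cons => /andP[l_pr t_pr] /andP[lt t_uniq].
have lN: l \in primes N by apply: (mem_subseq ts); rewrite mem_head.
rewrite Gauss_dvd; last by rewrite prime_coprime // prime_dvd_prod_primes.
rewrite IHt // ?(subseq_trans (subseq_cons _ _) ts) // andbT.
by move: lN; rewrite mem_primes => /and3P[].
Qed.

(** * Monic irreducible factors and squarefree divisors of a polynomial *)

Section IrreducibleFactors.
Variable F : finFieldType.
Implicit Types (P Q T g : {poly F}) (t : seq {poly F}).

Definition irr_factors T : seq {poly F} :=
  [seq polyn u | u <- enum [pred u : {poly_(size T) F} |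
      [&& polyn u \is monic, irreducibleb (polyn u) & polyn u %| T]]].

Lemma irr_factors_uniq T : uniq (irr_factors T).
Proof. by rewrite map_inj_uniq ?enum_uniq //; apply: val_inj. Qed.

Lemma mem_irr_factors T P : T != 0 ->
  (P \in irr_factors T) = [&& P \is monic, irreducibleb P & P %| T].
Proof.
move=> nzT; apply/mapP/idP => [[g] | PT].
  by rewrite mem_enum inE => gT ->.
have sP: (size P <= size T)%N by apply: dvdp_leq; case/and3P: PT.
by exists (NPoly sP); rewrite ?mem_enum ?inE.
Qed.

Lemma exists_irr_factor g : (1 < size g)%N ->
  exists2 P, (P \is monic) && irreducibleb P & P %| g.
Proof.
have [m] := ubnP (size g); elim: m g => // m IHm g; rewrite ltnS => gm g_gt1.
have nzg: g != 0 by rewrite -size_poly_gt0 ltnW.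
case: (boolP (irreducibleb g)) => [g_irr|].
  have nzl: (lead_coef g)^-1 != 0 by rewrite invr_eq0 lead_coef_eq0.
  exists ((lead_coef g)^-1 *: g); last by rewrite dvdpZl.
  rewrite monicE lead_coefZ mulVf ?lead_coef_eq0 // eqxx.
  have [_ g_dvd] := irreducibleP _ g_irr; apply/irreducibleP; split=> [|h h1].
    by rewrite size_scale.
  rewrite dvdpZr // => /(g_dvd h h1) hg; apply: eqp_trans hg _.
  by rewrite eqp_sym eqp_scale.
rewrite /irreducibleb g_gt1 => /forallPn[h].
rewrite negb_imply -Pdiv.Idomain.dvdpE -ltnNge => /andP[hg h_gt1].
(* The divisor [h] that refutes irreducibility ranges over sizes at most [(size g).-1], so it is
   proper. *)
have hm: (size h < m)%N.
  apply: leq_trans gm; rewrite (leq_ltn_trans (size_npoly h)) //.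
  by rewrite prednK ?(ltnW g_gt1) // ltn_predL ltnW.
have [P Pirr Ph] := IHm h hm h_gt1.
by exists P => //; apply: dvdp_trans hg.
Qed.

Definition monic_irr := [pred P : {poly F} | (P \is monic) && irreducibleb P].

Lemma monic_irr_dvdp P Q : monic_irr P -> monic_irr Q -> (P %| Q) = (P == Q).
Proof.
move=> /andP[Pm /irreducibleP[P1 _]] /andP[Qm /irreducibleP[_ Qd]].
apply/idP/eqP => [PQ|->]; last exact: dvdpp.
by apply/eqP; rewrite -eqp_monic // Qd // gtn_eqF.
Qed.

Lemma monic_irr_coprime P g : monic_irr P -> coprimep P g = ~~ (P %| g).
Proof. by case/andP=> _ /irreducibleP/irreducible_poly_coprime. Qed.

Lemma monic_irr_dvd_prod P t : monic_irr P -> all monic_irr t ->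
  (P %| \prod_(g <- t) g) = (P \in t).
Proof.
move=> P_irr; elim: t => [_|Q t IHt /= /andP[Q_irr /IHt{}IHt]].
  by rewrite big_nil dvdp1; case/and3P: P_irr => _ /gtn_eqF->.
rewrite big_cons in_cons -monic_irr_dvdp // -IHt.
case: (boolP (P %| Q)) => [PQ|]; first by rewrite dvdp_mulr.
by rewrite -monic_irr_coprime //= => /Gauss_dvdpr->.
Qed.

Lemma irr_factors_monic_irr T t : T != 0 -> {subset t <= irr_factors T} -> all monic_irr t.
Proof.
move=> nzT ts; apply/allP => P /ts; rewrite mem_irr_factors // => /and3P[Pm Pi _].
by rewrite inE Pm.
Qed.

Lemma prod_monic_irr_neq0 t : all monic_irr t -> \prod_(g <- t) g != 0.
Proof.
move=> /allP t_irr; rewrite prodf_seq_neq0; apply/allP => P /t_irr /andP[Pm _].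
exact: monic_neq0.
Qed.

Lemma prod_irr_factors_dvd T t : T != 0 -> uniq t -> {subset t <= irr_factors T} ->
  \prod_(g <- t) g %| T.
Proof.
move=> nzT; elim: t => [|P t IHt] /=; first by rewrite big_nil dvd1p.
case/andP=> Pt t_uniq ts; have := irr_factors_monic_irr nzT ts => /= /andP[P_irr t_irr].
have := ts P (mem_head _ _); rewrite mem_irr_factors // => /and3P[_ _ PT].
rewrite big_cons Gauss_dvdp ?PT ?IHt // => [Q Qt|]; first by rewrite ts // in_cons Qt orbT.
by rewrite monic_irr_coprime // monic_irr_dvd_prod.
Qed.

Lemma Wpoly_ge T : T != 0 -> (2 ^ size (irr_factors T) <= Wpoly T)%N.
Proof.
move=> nzT; rewrite -(size_subprods *%R 1) /Wpoly cardE -(size_map (@polyn _ _)).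
have sub_irr t : subseq t (irr_factors T) -> all monic_irr t.
  by move=> ts; apply: irr_factors_monic_irr nzT (mem_subseq ts).
apply: uniq_leq_size => [|g /mem_subprods[t ts ->]].
  apply: (@subprods_uniq _ _ _ (fun P g => P %| g)) (irr_factors_uniq T) => [P|P g|P PT t ts].
  - by rewrite mem_irr_factors // => /andP[Pm _]; apply: mulfI; apply: monic_neq0.
  - exact: dvdp_mulr.
  rewrite monic_irr_dvd_prod ?sub_irr //.
  by move: PT; rewrite mem_irr_factors // inE => /and3P[-> ->].
have t_irr := sub_irr t ts; have t_uniq := subseq_uniq ts (irr_factors_uniq T).
have gT := prod_irr_factors_dvd nzT t_uniq (mem_subseq ts).
have sg := dvdp_leq nzT gT; apply/mapP; exists (NPoly sg) => //.
rewrite mem_enum inE /= gT /sqfree_poly prod_monic_irr_neq0 //=.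
apply/andP; split; first by rewrite big_seq monic_prod // => P /(allP t_irr)/andP[].
apply/forallP => h; apply/implyP => hh; rewrite leqNgt; apply/negP.
move=> /exists_irr_factor[P P_irr Ph].
have pp: P * P %| \prod_(g <- t) g by apply: dvdp_trans hh; apply: dvdp_mul.
have pt: P \in t by rewrite -monic_irr_dvd_prod //; apply: dvdp_trans pp; apply: dvdp_mulr.
move: pp; rewrite (perm_big _ (perm_to_rem pt)) big_cons dvdp_mul2l; last first.
  by case/andP: P_irr => /monic_neq0.
rewrite monic_irr_dvd_prod ?mem_rem_uniqF //.
by apply/allP => Q /mem_rem/(allP t_irr).
Qed.

End IrreducibleFactors.

(** The hypothesis says that the [V i] behave as independent events of probability [x i]. Carrying
    the list [t] of required memberships makes the induction work: avoiding [V j] is everything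
    minus the case where [j] joins [t]. *)
Lemma card_sieve (X : finType) (I : eqType) (V : I -> {set X})
    (x : I -> algC) (s0 s t : seq I) (Q : algC) :
    (forall t, uniq t -> {subset t <= s0} ->
       #|[set a | all (fun i => a \in V i) t]|%:R = Q * \prod_(i <- t) x i) ->
    uniq (s ++ t) -> {subset s ++ t <= s0} ->
  #|[set a | all (fun i => a \in V i) t && all (fun i => a \notin V i) s]|%:R
    = Q * \prod_(i <- t) x i * \prod_(i <- s) (1 - x i).
Proof.
move=> Vt; elim: s t => [|j s IHs] t /= st_uniq st_sub.
  by rewrite big_nil mulr1 -Vt //; congr _%:R; apply: eq_card => a; rewrite !inE andbT.
have jst_perm: perm_eq (s ++ j :: t) (j :: s ++ t) by rewrite perm_catC /= perm_cons perm_catC.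
have e1 := IHs t; have e2 := IHs (j :: t).
rewrite (perm_uniq jst_perm) /= in e2; case/andP: (st_uniq) => _ st_uniq'.
rewrite big_cons mulrA mulrBr mulr1 mulrBl -e1 //; last first.
  by move=> i si; rewrite st_sub // in_cons si orbT.
have ->: Q * \prod_(i <- t) x i * x j = Q * \prod_(i <- j :: t) x i.
  by rewrite big_cons mulrA [RHS]mulrAC.
rewrite -e2 //; last by move=> i; rewrite (perm_mem jst_perm); apply: st_sub.
apply/eqP; rewrite eq_sym subr_eq -natrD; apply/eqP; congr _%:R.
rewrite -[LHS](cardsID (V j)) addnC; congr (_ + _)%N; apply: eq_card => a; rewrite !inE /=.
  by rewrite andbA [in RHS]andbA; congr (_ && _); rewrite andbC.
by rewrite [LHS]andbC andbA.
Qed.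

(** * Normal elements *)

Section NormalElements.
Variables (F : finFieldType) (L : fieldExtType F).
Local Notation q := #|F|.
Local Notation n := (\dim {:L}).
Local Notation K := (finvect_type L).
Local Notation T := ('X^n - 1 : {poly F}).
Local Notation s := (irr_factors T).
Implicit Types (f g P : {poly F}) (a : K) (t : seq {poly F}).

Let nzT : T != 0 := Xn_sub1_neq0 L.

(** For nonzero [g], the order of [F[x]/(g)]. *)
Definition qdeg g : nat := (q ^ (size g).-1)%N.

Lemma qdeg_gt0 g : (0 < qdeg g)%N.
Proof. by rewrite expn_gt0 ltnW ?finNzRing_gt1. Qed.

Lemma qdegM f g : f != 0 -> g != 0 -> qdeg (f * g) = (qdeg f * qdeg g)%N.
Proof.
rewrite -!size_poly_gt0 /qdeg => f0 g0; rewrite size_mul -?size_poly_gt0 // -expnD.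
by rewrite -{1}(prednK f0) -{1}(prednK g0) addSn addnS.
Qed.

Lemma qdeg_prod t : all (@monic_irr F) t -> qdeg (\prod_(P <- t) P) = (\prod_(P <- t) qdeg P)%N.
Proof.
elim: t => [_|P t IHt /= /andP[P_irr t_irr]]; first by rewrite !big_nil /qdeg size_poly1.
rewrite !big_cons qdegM ?IHt ?prod_monic_irr_neq0 //.
by case/andP: P_irr => /monic_neq0.
Qed.

Lemma card_ker_q_assoc f : f %| T -> #|[set a : K | q_assoc f a == 0]| = qdeg f.
Proof.
move=> fT; have f_gt0: (0 < size f)%N by rewrite size_poly_gt0; apply: dvdpN0 fT nzT.
rewrite /qdeg -(@dim_ker_q_assoc _ K f _ fT (esym (prednK f_gt0))) -card_vspace.
by apply: eq_card => a; rewrite inE memv_ker lfunE.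
Qed.

Lemma card_img_q_assoc f k : f %| T -> size f = k.+1 ->
  (#|(q_assoc f : K -> K) @: K| * q ^ k = #|K|)%N.
Proof.
move=> fT fk; rewrite (card_finvect L) -[in RHS](@dim_img_q_assoc _ K f k fT fk) expnD -card_vspace.
congr (_ * _)%N; apply: eq_card => b.
by apply/imsetP/memv_imgP => -[a _ ->]; exists a; rewrite ?memvf ?lfunE.
Qed.

(** For [P] in [irr_factors T] these are the maximal submodules of the [F[x]]-module [K]. *)
Definition factor_ker P : {set K} := [set a : K | q_assoc (T %/ P) a == 0].

(** By Bezout for the coprime [P] and [M], an element killed by both [R * P] and [R * M] is killed
    by [R]. *)
Lemma factor_ker_all t a : uniq t -> {subset t <= s} ->
  all (fun P => a \in factor_ker P) t = (q_assoc (T %/ \prod_(P <- t) P) a == 0).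
Proof.
elim: t => [_ _|P t IHt /= /andP[Pt t_uniq] ts].
  by rewrite big_nil divp1 (q_assocXn_sub1 (L := K)) eqxx.
have ts': {subset t <= s} by move=> Q Qt; rewrite ts // in_cons Qt orbT.
have /= /andP[P_irr t_irr] := irr_factors_monic_irr nzT ts.
have PtT : \prod_(Q <- P :: t) Q %| T by apply: prod_irr_factors_dvd => //=; rewrite Pt.
rewrite IHt // !big_cons inE; rewrite big_cons in PtT; set M := \prod_(Q <- t) Q in PtT *.
have nzP: P != 0 by case/andP: P_irr => /monic_neq0.
have nzM: M != 0 by apply: prod_monic_irr_neq0.
have co: coprimep P M by rewrite monic_irr_coprime // monic_irr_dvd_prod.
have TE := divpK PtT; set R := T %/ (P * M) in TE *.
have ->: T %/ P = R * M by rewrite -TE mulrCA mulrC mulpK.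
have ->: T %/ M = R * P by rewrite -TE mulrA mulpK.
apply/andP/eqP => [[/eqP RM /eqP RP]|R0]; last first.
  by split; apply/eqP; apply: q_assoc_dvdp R0; apply: dvdp_mulr.
have [[u v] /= uv] := Bezout_eq1_coprimepP _ _ co.
have ->: R = u * (R * P) + v * (R * M) by rewrite !(mulrCA _ R) -mulrDr uv mulr1.
by rewrite q_assocD !q_assocM -!(q_assocM R) RM RP !linear0 addr0.
Qed.

(** If [g] kills [a], so does [d], the gcd of [T] and [g]. When [T %/ d] is not constant it has an
    irreducible factor [P]; then [d] divides [T %/ P], which puts [a] in [factor_ker P]. *)
Lemma normal_factor_ker a : normal_elt a = all (fun P => a \notin factor_ker P) s.
Proof.
apply/(normal_eltP (L := K))/allP => [ann P Ps|nV g g0].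
  move: Ps; rewrite mem_irr_factors // inE => /and3P[Pm /irreducibleP[P1 _] PT].
  apply/negP => /eqP/ann; have TE := divpK PT.
  have nzTP: T %/ P != 0 by apply: contraNneq nzT => TP0; rewrite -TE TP0 mul0r.
  rewrite -{1}TE -[X in _ %| X]mulr1 dvdp_mul2l // dvdp1 => /eqP e.
  by rewrite e in P1.
pose d := gcdp T g; have dT: d %| T := dvdp_gcdl T g.
have d0: q_assoc d a = 0.
  have [[u v] /= uv] := Bezoutp T g.
  apply: q_assoc_dvdp (_ : q_assoc (u * T + v * g) a = 0); first by rewrite (eqp_dvdl _ uv) dvdpp.
  by rewrite q_assocD !q_assocM g0 (q_assocXn_sub1 (L := K)) !linear0 addr0.
have TE := divpK dT.
have nzTd: T %/ d != 0 by apply: contraNneq nzT => Td0; rewrite -TE Td0 mul0r.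
have [Td1|] := leqP (size (T %/ d)) 1.
  apply: dvdp_trans (dvdp_gcdr T g); rewrite -{1}TE.
  have /size_poly1P[c nzc ->]: size (T %/ d) == 1%N by rewrite eqn_leq Td1 size_poly_gt0.
  by rewrite mul_polyC dvdpZl.
move/exists_irr_factor=> [P /andP[Pm Pi] PTd].
have PT: P %| T by rewrite -TE dvdp_mulr.
have Ps: P \in s by rewrite mem_irr_factors // Pm Pi.
have := nV P Ps; rewrite inE => /eqP[]; apply: q_assoc_dvdp d0.
by rewrite -TE -(divpK PTd) mulrAC mulpK ?monic_neq0 // dvdp_mull.
Qed.

Let density P : algC := (qdeg P)%:R^-1.

Lemma card_factor_ker t : uniq t -> {subset t <= s} ->
  #|[set a | all (fun P => a \in factor_ker P) t]|%:R = (q ^ n)%:R * \prod_(P <- t) density P.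
Proof.
move=> t_uniq ts; have tT := prod_irr_factors_dvd nzT t_uniq ts.
have t_irr := irr_factors_monic_irr nzT ts.
have TE := divpK tT; set M := \prod_(P <- t) P in TE tT.
have nzTM: T %/ M != 0 by apply: contraNneq nzT => T0; rewrite -TE T0 mul0r.
have ->: [set a | all (fun P => a \in factor_ker P) t] = [set a : K | q_assoc (T %/ M) a == 0].
  by apply/setP => a; rewrite !inE factor_ker_all.
rewrite card_ker_q_assoc; last by rewrite -{2}TE dvdp_mulr.
have ->: (q ^ n)%N = qdeg T by rewrite /qdeg size_Xn_sub1.
rewrite -[in RHS]TE qdegM ?prod_monic_irr_neq0 // qdeg_prod // natrM natr_prod.
rewrite -mulrA -big_split big1 ?mulr1 //= => P _.
by rewrite mulfV // pnatr_eq0 -lt0n qdeg_gt0.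
Qed.

Lemma card_normal : #|[set a : K | normal_elt a]|%:R = (q ^ n)%:R * \prod_(P <- s) (1 - density P).
Proof.
have := @card_sieve _ _ factor_ker density s s [::] _ card_factor_ker.
rewrite cats0 big_nil mulr1 => <- //; last exact: irr_factors_uniq.
by congr _%:R; apply: eq_card => a; rewrite !inE normal_factor_ker.
Qed.

Lemma sieve_gt0 : 0 < \prod_(P <- s) (1 - density P).
Proof.
rewrite big_seq prodr_gt0 // => P; rewrite mem_irr_factors // => /and3P[_ /irreducibleP[P1 _] _].
rewrite subr_gt0 invf_lt1 ?ltr0n ?qdeg_gt0 // ltr1n /qdeg.
by rewrite -[1%N](expn0 q) ltn_exp2l ?finNzRing_gt1 // -ltnS prednK // ltnW.
Qed.

(** For a normal [a0], the map [u -> L_u(a0)] is a bijection from [F[x]/(T)] onto [K] that matches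
    units with normal elements. *)
Lemma Phi_poly_normal : Phi_poly T = #|[set a : K | normal_elt a]|.
Proof.
(* Positivity of the sieve product yields the normal basis theorem. *)
have [a0 na0]: exists a : K, normal_elt a.
  have: (0 < #|[set a : K | normal_elt a]|)%N.
    rewrite -(ltr0n algC) card_normal mulr_gt0 ?sieve_gt0 // ltr0n expn_gt0.
    by rewrite ltnW ?finNzRing_gt1.
  by case/card_gt0P=> a; rewrite inE; exists a.
have T1: (1 < size T)%N by rewrite size_Xn_sub1 ltnS adim_gt0.
have Tm: T \is monic by rewrite monicXnsubC ?adim_gt0.
(* The quotient [{poly %/ T}] is built on [mk_monic T], which is [T] because [T] is monic and
   nonconstant. *)
have mkT: mk_monic T = T by rewrite /mk_monic T1 Tm.
pose h (u : {poly %/ T}) : K := q_assoc (polyn u) a0.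
have h_inj: injective h.
  move=> u v /eqP; rewrite -subr_eq0 -q_assocB => /eqP/(normal_eltP (L := K) _ na0) Tuv.
  apply/val_inj/eqP; rewrite -subr_eq0; apply: contraTT Tuv => nzuv.
  apply/negP => /(dvdp_leq nzuv); rewrite leqNgt.
  have su w: (size (polyn (w : {poly %/ T})) < size T)%N.
    by apply: leq_trans (size_mk_monic w) _; rewrite mkT.
  by rewrite (leq_ltn_trans (size_polyD _ _)) // size_polyN gtn_max !su.
have h_bij: bijective h.
  by apply: inj_card_bij h_inj _; rewrite card_monic_qpoly // (card_finvect L) size_Xn_sub1.
rewrite -(on_card_preimset (onW_bij _ h_bij)); apply: eq_card => u.
have coE g : coprimep (mk_monic T) g = coprimep T g by rewrite mkT.
by rewrite !inE (normal_elt_q_assoc (L := K) _ na0) -coE.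
Qed.

Lemma Theta_poly_prod : ratr (Theta_poly T) = \prod_(P <- s) (1 - density P) :> algC.
Proof.
rewrite /Theta_poly Phi_poly_normal fmorph_div /= !ratr_nat card_normal size_Xn_sub1 mulrC mulKf //.
by rewrite pnatr_eq0 -lt0n expn_gt0 ltnW ?finNzRing_gt1.
Qed.

Section Fourier.
Variable psi : K -> algC.
Hypothesis psiD : {morph psi : x y / x + y >-> x * y}.
Hypothesis psi_norm : forall x, `|psi x| = 1.
Hypothesis psi_nontriv : exists x, psi x != 1.

Lemma normal_fourier_bound :
  fourier_bound (fun c a => psi (c * a)) (fun a => (a \in [set a : K | normal_elt a])%:R)
    ((2 ^ size s)%:R * ratr (Theta_poly T)).
Proof.
have chi0 a : psi (0 * a) = 1 by rewrite mul0r (psi0 psiD psi_norm).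
have chiD c d a : psi ((c + d) * a) = psi (c * a) * psi (d * a) by rewrite mulrDl psiD.
have [|c cE cr] := fourier_bound_prod (chi := fun c a : K => psi (c * a)) chi0 chiD
   (s := s) (u := fun P a => 1 - (a \in factor_ker P)%:R) (r := fun P => 2%:R * (1 - density P)).
  move=> P Ps; have PT: P %| T by move: Ps; rewrite mem_irr_factors // => /and3P[].
  have V0: 0 \in factor_ker P by rewrite inE linear0.
  have VD: {in factor_ker P &, forall a b, a + b \in factor_ker P}.
    by move=> a b; rewrite !inE linearD /= => /eqP-> /eqP->; rewrite addr0.
  have VN: {in factor_ker P, forall a, - a \in factor_ker P}.
    by move=> a; rewrite !inE linearN /= => /eqP->; rewrite oppr0.
  have PE := divpK PT.
  have VE: #|factor_ker P| = qdeg (T %/ P) by rewrite card_ker_q_assoc // -{2}PE dvdp_mulr.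
  have nzP: P != 0 := dvdpN0 PT nzT.
  have nzTP: T %/ P != 0 by apply: contraNneq nzT => TP0; rewrite -PE TP0 mul0r.
  (* The annihilator has order [q ^ n] divided by [qdeg (T %/ P)], that is [qdeg P]. *)
  have ->: density P = #|psi_ann psi (factor_ker P)|%:R^-1.
    congr _%:R^-1; apply/eqP; rewrite -(eqn_pmul2l (qdeg_gt0 (T %/ P))) -qdegM // PE -VE.
    by rewrite (card_psi_ann psiD psi_norm psi_nontriv) // /qdeg size_Xn_sub1 (card_finvect L).
  apply: (fourier_bound_complement chi0) => [|a]; first exact: (psi_ann0 psiD psi_norm).
  by rewrite (indicator_psi_ann psiD psi_norm psi_nontriv a V0 VD VN).
exists c => [a|].
  rewrite -cE inE normal_factor_ker; elim: (s) => [|P t IHt] /=; first by rewrite big_nil.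
  by rewrite big_cons -IHt; case: (a \in factor_ker P); rewrite ?subrr ?mul0r // subr0 mul1r.
apply: le_trans cr _; rewrite big_split /= Theta_poly_prod big_const_seq count_predT iter_mulr_1.
by rewrite natrX.
Qed.
End Fourier.
End NormalElements.

(** * The lower bound for [n_f] and the existence of primitive [k]-normal elements *)

(** This is [card_primitive_values] for the normal elements, with [kappa = q ^ k] and
    [r = 2^omega(T) Theta(T)]. The [- 1] left by the trivial character is what later makes the
    inequality strict. *)
Lemma n_f_lower_bound (F : finFieldType) (L : fieldExtType F) (f : {poly F}) (k n N : nat)
    (th Th : algC) :
    n = \dim {:L} -> N = (#|F| ^ n - 1)%N -> f %| 'X^n - 1 -> size f = k.+1 -> (k < n)%N ->
    th = ratr (theta N) -> Th = ratr (Theta_poly ('X^n - 1 : {poly F})) ->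
  th * Th * ((#|F| ^ n)%:R - ((2 ^ size (primes N) - 1) *
     2 ^ size (irr_factors ('X^n - 1 : {poly F})) * #|F| ^ k)%:R * sqrtC (#|F| ^ n)%:R)
   <= (n_f L f)%:R.
Proof.
move=> -> NE fT fk kn thE ThE.
have [psi psiD [psi_norm psi_nontriv]] := exists_additive_character (finvect_type L).
have KN: #|finvect_type L| = N.+1.
  by rewrite (card_finvect L) NE subn1 prednK // expn_gt0 ltnW ?finNzRing_gt1.
pose l : finvect_type L -> finvect_type L := q_assoc f.
have lD: {morph l : a b / a + b} by move=> a b; rewrite /l linearD.
(* A normal [a] killed by [L_f] would make ['X^n - 1] divide [f], whose degree [k] is below [n]. *)
have lS: {in [set a : finvect_type L | normal_elt a], forall a, l a != 0}.
  move=> a; rewrite inE => /(normal_eltP (L := finvect_type L)) na; apply/eqP => /na.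
  have nzf: f != 0 by rewrite -size_poly_eq0 fk.
  by move/(dvdp_leq nzf); rewrite (size_Xn_sub1 (finvect_type L)) fk ltnS leqNgt kn.
have := card_primitive_values psiD psi_norm psi_nontriv KN lD (card_img_q_assoc fT fk) lS
   (normal_fourier_bound psiD psi_norm psi_nontriv).
have ->: #|[set a in [set a : finvect_type L | normal_elt a] | N.-primitive_root (l a)]| = n_f L f.
  by apply: eq_card => a; rewrite !inE NE.
have th_E: (totient N)%:R / N%:R = th by rewrite thE /theta fmorph_div /= !ratr_nat.
rewrite card_normal -Theta_poly_prod (card_finvect L) th_E -ThE => le_norm.
(* The order on [algC] is partial, and bounding a number by its norm requires it to be real. *)
have thR: th \is Num.real by rewrite -th_E realM ?realV ?realn.
have ThR: Th \is Num.real.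
  by rewrite ThE /Theta_poly fmorph_div /= !ratr_nat realM ?realV ?realn.
rewrite mulrBr lerBlDr -lerBlDl.
apply: (@le_trans _ _ `|th * ((#|F| ^ \dim {:L})%:R * Th) - (n_f L f)%:R|).
  rewrite (_ : th * Th * _ = th * ((#|F| ^ \dim {:L})%:R * Th)); last by ring.
  by rewrite real_ler_norm // realB ?realM ?realn.
rewrite distrC; apply: (le_trans le_norm); rewrite !natrM.
have mulE (u v w x y z : algC) : u * v * (w * x * (y * z)) = u * x * (v * w * y * z).
  by ring.
by rewrite mulE.
Qed.

(** [L_f] is linear and commutes with the Frobenius map, so the conjugates of [L_f(a)] are the
    images of a basis and span the image of [L_f]. *)
Lemma primitive_k_normal (F : finFieldType) (L : fieldExtType F) (f : {poly F}) (k : nat) (a : L) :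
    f %| 'X^(\dim {:L}) - 1 -> size f = k.+1 -> normal_elt a ->
  k_normal k (q_assoc f a).
Proof.
move=> fT fk /span_basis a_span; rewrite /k_normal.
rewrite -[X in (X - k)%N](dim_img_q_assoc fT fk) addnK -a_span limg_span.
apply/eqP; congr (\dim <<_>>%VS); rewrite -map_comp; apply: eq_map => i /=.
rewrite lfunE /=; elim: i => [|i IHi]; first by rewrite expn0 !expr1.
by rewrite expnSr !exprM IHi q_assoc_frobenius.
Qed.

Theorem theorem3p3 (F : finFieldType) (L : fieldExtType F) (n k : nat)
  (hn : \dim {:L} = n) (n_pos : (0 < n)%N)
  (f : {poly F}) (hf : f %| 'X^n - 1) (hk : size f = k.+1) :
  let q := #|F| in
  let Nf : algC := (n_f L f)%:R in
  let th : algC := ratr (theta (q ^ n - 1)) in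
  let Th : algC := ratr (Theta_poly ('X^n - 1 : {poly F})) in
  let WW : algC := (Wnat (q ^ n - 1) * Wpoly ('X^n - 1 : {poly F}))%:R in
  (* q^{n/2 + k} = sqrt(q^n) * q^k ; q^{n/2 - k} = sqrt(q^n) / q^k *)
  Nf / (th * Th) > (q ^ n)%:R - sqrtC ((q ^ n)%:R) * (q ^ k)%:R * WW
  /\ (sqrtC ((q ^ n)%:R) / (q ^ k)%:R >= WW ->
      exists a : L, primitive_elt a && k_normal k a).
Proof.
move=> q Nf th Th WW; set T := 'X^n - 1 : {poly F}.
have q_gt1: (1 < q)%N := finNzRing_gt1 F.
have qn_gt1: (1 < q ^ n)%N by rewrite -[1%N](expn0 q) ltn_exp2l.
have N_gt0: (0 < q ^ n - 1)%N by rewrite subn_gt0.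
have th_gt0: 0 < th.
  by rewrite /th /theta fmorph_div /= !ratr_nat divr_gt0 // ltr0n ?totient_gt0.
have Th_gt0: 0 < Th by rewrite /Th -hn Theta_poly_prod sieve_gt0.
have thTh_gt0: 0 < th * Th by rewrite mulr_gt0.
have nzT: T != 0 by rewrite /T -hn Xn_sub1_neq0.
have sqrt_gt0: 0 < sqrtC (q ^ n)%:R :> algC by rewrite sqrtC_gt0 ltr0n ltnW.
have qk_gt0: 0 < (q ^ k)%:R :> algC by rewrite ltr0n expn_gt0 ltnW.
have leW: (2 ^ size (primes (q ^ n - 1)) * 2 ^ size (irr_factors T)
            <= Wnat (q ^ n - 1) * Wpoly T)%N.
  by rewrite leq_mul ?Wnat_ge ?Wpoly_ge.
have main: Nf / (th * Th) > (q ^ n)%:R - sqrtC ((q ^ n)%:R) * (q ^ k)%:R * WW.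
  rewrite ltr_pdivlMr // mulrC.
  have [kn|nk] := ltnP k n.
    apply: lt_le_trans (n_f_lower_bound (esym hn) erefl hf hk kn erefl erefl).
    rewrite ltr_pM2l // ltrD2l ltrN2 -mulrA [ltRHS]mulrC ltr_pM2r //.
    rewrite -natrM ltr_nat mulnC ltn_pmul2l ?expn_gt0 ?(ltnW q_gt1) //.
    apply: leq_trans leW; rewrite ltn_pmul2r ?expn_gt0 // subn1 ltn_predL expn_gt0 //.
  (* Here [n <= k], and the subtracted term exceeds [q ^ k >= q ^ n] since the square root is above
     1 and [WW >= 1]. *)
  apply: lt_le_trans (ler0n _ _); rewrite pmulr_rlt0 // subr_lt0.
  rewrite mulrAC mulrC; apply: (@le_lt_trans _ _ (q ^ k)%:R); first by rewrite ler_nat leq_exp2l.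
  rewrite ltr_pMr //; apply: (@lt_le_trans _ _ (sqrtC (q ^ n)%:R)).
    by rewrite -[ltLHS]sqrtC1 ltr_sqrtC ?ltr1n // nnegrE ?ler01 ?ler0n.
  by rewrite ler_peMr ?(ltW sqrt_gt0) // ler1n (leq_trans _ leW) // muln_gt0 !expn_gt0.
split=> // leWW; have: 0 < Nf.
  rewrite -(pmulr_lgt0 _ (_ : 0 < (th * Th)^-1)) ?invr_gt0 //.
  (* Writing [q ^ n] as the square of its root, the hypothesis says that the lower bound is
     nonnegative; strictness of [main] then gives a positive count. *)
  apply: le_lt_trans main; rewrite subr_ge0.
  rewrite -[leRHS]sqrtCK expr2 -mulrA ler_pM2l // mulrC -ler_pdivlMr //.
rewrite ltr0n => /card_gt0P[a]; rewrite inE => /andP[na pa].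
exists (q_assoc f a); rewrite pa /=.
by apply: primitive_k_normal na; rewrite ?hn.
Qed.
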